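(* Let $\mathcal B$ be a 2-category and $x$ an object of $\mathcal B$. Then the object $(x,1_x)$ is biterminal in $(\mathcal B_{/x})_{\mathrm{cart}}$.
   Context: 2-categories are strict; composition of 1-cells and whiskering are written by juxtaposition, and $\circ$ denotes vertical composition of 2-cells. Lax slice $\mathcal B_{/x}$. Objects: pairs $(y,\alpha)$ with $\alpha\colon y\to x$ a 1-cell. 1-cells $(y,\alpha)\to(z,\beta)$: pairs $(f,\gamma)$ with $f\colon y\to z$ and a 2-cell $\gamma\colon\beta f\to\alpha$. 2-cells $(f,\gamma)\to(g,\delta)$: 2-cells $\Xi\colon f\to g$ of $\mathcal B$ with $\delta\circ(\beta\Xi)=\gamma$. Composition: $(g,\delta)(f,\gamma)=(gf,\ \gamma\circ(\delta f))$. Let $p\colon\mathcal B_{/x}\to\mathcal B$ be the projection $(y,\alpha)\mapsto y$, $(f,\gamma)\mapsto f$, $\Xi\mapsto\Xi$. For a 2-functor $p\colon\mathcal E\to\mathcal B$, a 1-cell $f\colon u\to v$ of $\mathcal E$ is $p$-cartesian if for every object $a$ of $\mathcal E$ the square with $f\circ-\colon\mathcal E(a,u)\to\mathcal E(a,v)$ over $p(f)\circ-\colon\mathcal B(pa,pu)\to\mathcal B(pa,pv)$ is a (strict) pullback of categories. The sub-2-category $\mathcal E_{\mathrm{cart}}\subseteq\mathcal E$ has all objects of $\mathcal E$, and $\mathcal E_{\mathrm{cart}}(u,v)$ is the full subcategory of $\mathcal E(u,v)$ spanned by the $p$-cartesian 1-cells. An object $t$ of a 2-category $\mathcal D$ is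 biterminal if for every object $z$ the category $\mathcal D(z,t)$ is equivalent to the terminal category. *)

(* Defs.v *)
From Stdlib Require Import ssreflect.
From Stdlib Require Import ProofIrrelevance FunctionalExtensionality.

Set Implicit Arguments.
Unset Strict Implicit.
Unset Printing Implicit Defensive.

Declare Scope cat_scope.
Delimit Scope cat_scope with cat.
Local Open Scope cat_scope.

Reserved Notation "a ~> b" (at level 70, no associativity).
Reserved Notation "g ∘ f" (at level 40, left associativity).
Reserved Notation "g ⋅ f" (at level 38, left associativity).
Reserved Notation "b ⋆ a" (at level 38, left associativity).

Record Category := {
  Ob :> Type;
  arr : Ob -> Ob -> Type;
  idc : forall a, arr a a;
  vcomp : forall a b c, arr b c -> arr a b -> arr a c;
  vcomp_idl : forall a b (f : arr a b), vcomp (idc b) f = f;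
  vcomp_idr : forall a b (f : arr a b), vcomp f (idc a) = f;
  vcomp_assoc : forall a b c d (h : arr c d) (g : arr b c) (f : arr a b),
    vcomp h (vcomp g f) = vcomp (vcomp h g) f
}.

Arguments arr {c} a b : rename.
Arguments idc {c} a : rename.
Arguments vcomp {c a b c0} g f : rename.

Notation "a ~> b" := (arr a b) : cat_scope.
Notation "g ∘ f" := (vcomp g f) : cat_scope.

(* Transport of an arrow along equalities of its source and target. *)
Definition cast {C : Category} {a a' b b' : C} (ea : a = a') (eb : b = b')
    (f : a ~> b) : a' ~> b' :=
  match ea in _ = x, eb in _ = y return x ~> y with
  | eq_refl, eq_refl => f
  end.

Lemma cast_id (C : Category) (a b : C) (ea : a = a) (eb : b = b) (f : a ~> b) :
  cast ea eb f = f.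
Proof.
by rewrite (proof_irrelevance _ ea eq_refl) (proof_irrelevance _ eb eq_refl).
Qed.

Lemma cast_pi (C : Category) (a b a' b' : C) (ea ea' : a = a') (eb eb' : b = b')
    (f : a ~> b) : cast ea eb f = cast ea' eb' f.
Proof.
by rewrite (proof_irrelevance _ ea ea') (proof_irrelevance _ eb eb').
Qed.

Lemma cast_cast (C : Category) (a b a' b' a'' b'' : C) (ea : a = a')
    (eb : b = b') (ea' : a' = a'') (eb' : b' = b'') (f : a ~> b) :
  cast ea' eb' (cast ea eb f) = cast (eq_trans ea ea') (eq_trans eb eb') f.
Proof. by case: _ / ea' ; case: _ / eb'. Qed.

Lemma cast_vcomp (C : Category) (a b c a' b' c' : C) (ea : a = a')
    (eb eb' : b = b') (ec : c = c') (g : b ~> c) (f : a ~> b) :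
  cast eb ec g ∘ cast ea eb' f = cast ea ec (g ∘ f).
Proof.
rewrite (proof_irrelevance _ eb' eb).
by case: _ / ea; case: _ / eb; case: _ / ec.
Qed.

Lemma cast_vcompr (C : Category) (a b c a' : C) (e : a = a') (g : b ~> c)
    (f : a ~> b) : cast e eq_refl (g ∘ f) = g ∘ cast e eq_refl f.
Proof. by case: _ / e. Qed.

Lemma cast_idc (C : Category) (a a' : C) (e e' : a = a') :
  cast e e' (idc a) = idc a'.
Proof. by rewrite (proof_irrelevance _ e' e); case: _ / e. Qed.

Lemma cast_move (C : Category) (a b a' b' : C) (ea : a = a') (eb : b = b')
    (f : a ~> b) (g : a' ~> b') :
  f = cast (eq_sym ea) (eq_sym eb) g -> cast ea eb f = g.
Proof. by move=> ->; rewrite cast_cast cast_id. Qed.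

Record Functor (C D : Category) := {
  fob :> C -> D;
  fmap : forall a b : C, a ~> b -> fob a ~> fob b;
  fmap_id : forall a, fmap (idc a) = idc (fob a);
  fmap_vcomp : forall (a b c : C) (g : b ~> c) (f : a ~> b),
    fmap (g ∘ f) = fmap g ∘ fmap f
}.

Arguments fmap {C D} F {a b} f : rename.

Definition idF (C : Category) : Functor C C :=
  @Build_Functor C C (fun a => a) (fun _ _ f => f)
    (fun _ => eq_refl) (fun _ _ _ _ _ => eq_refl).

Definition compF (C D E : Category) (G : Functor D E) (F : Functor C D) :
  Functor C E.
Proof.
refine (@Build_Functor C E (fun a => G (F a)) (fun _ _ f => fmap G (fmap F f)) _ _).
- by move=> a; rewrite !fmap_id.
- by move=> a b c g f; rewrite !fmap_vcomp.
Defined.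

Lemma fmap_cast (C D : Category) (F : Functor C D) (a b a' b' : C) (ea : a = a')
    (eb : b = b') (f : a ~> b) :
  fmap F (cast ea eb f) = cast (f_equal F ea) (f_equal F eb) (fmap F f).
Proof. by case: _ / ea; case: _ / eb. Qed.

Lemma functor_ext (C D : Category) (F G : Functor C D) (e : forall a, F a = G a) :
  (forall a b (f : a ~> b), cast (e a) (e b) (fmap F f) = fmap G f) -> F = G.
Proof.
case: F G e => [F0 F1 Fi Fc] [G0 G1 Gi Gc] /= e.
have E : F0 = G0 by apply: functional_extensionality.
move: e; case: _ / E G1 Gi Gc => G1 Gi Gc e H.
have E1 : F1 = G1.
  apply: functional_extensionality_dep => a.
  apply: functional_extensionality_dep => b.
  apply: functional_extensionality => f.
  by rewrite -H cast_id.
case: _ / E1 Gi Gc H => Gi Gc _.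
by rewrite (proof_irrelevance _ Fi Gi) (proof_irrelevance _ Fc Gc).
Qed.

Lemma compF_assoc (A B C D : Category) (H : Functor C D) (G : Functor B C)
    (F : Functor A B) : compF H (compF G F) = compF (compF H G) F.
Proof. by apply: (@functor_ext _ _ (compF H (compF G F)) (compF (compF H G) F) (fun _ => eq_refl)). Qed.

Lemma compF_idl (A B : Category) (F : Functor A B) : compF (idF B) F = F.
Proof. by apply: (@functor_ext _ _ (compF (idF B) F) F (fun _ => eq_refl)). Qed.

Lemma compF_idr (A B : Category) (F : Functor A B) : compF F (idF A) = F.
Proof. by apply: (@functor_ext _ _ (compF F (idF A)) F (fun _ => eq_refl)). Qed.

Definition is_iso (C : Category) (a b : C) (f : a ~> b) : Prop :=
  exists g : b ~> a, g ∘ f = idc a /\ f ∘ g = idc b.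

Definition naturally_isomorphic (C D : Category) (F G : Functor C D) : Prop :=
  exists eta : forall a : C, F a ~> G a,
    (forall (a b : C) (f : a ~> b), eta b ∘ fmap F f = fmap G f ∘ eta a) /\
    (forall a, is_iso (eta a)).

Definition equivalent (C D : Category) : Prop :=
  exists (F : Functor C D) (G : Functor D C),
    naturally_isomorphic (compF G F) (idF C) /\
    naturally_isomorphic (compF F G) (idF D).

Definition terminal_category : Category.
Proof.
refine (@Build_Category unit (fun _ _ => unit) (fun _ => tt)
          (fun _ _ _ _ _ => tt) _ _ _) => //.
- by move=> ? ? [].
- by move=> ? ? [].
Defined.

(* The square
       A --- P ---> B
       |            |
       Q            F
       v            v
       C --- G ---> D
   is a strict pullback in the 1-category of categories and functors. *)
Definition is_pullback (A B C D : Category) (P : Functor A B) (Q : Functor A C)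
    (F : Functor B D) (G : Functor C D) : Prop :=
  compF F P = compF G Q /\
  forall (X : Category) (S : Functor X B) (T : Functor X C),
    compF F S = compF G T ->
    exists! U : Functor X A, compF P U = S /\ compF Q U = T.

(* Full subcategory spanned by the objects satisfying [P]. *)
Record full_ob (C : Category) (P : C -> Prop) := {
  fval :> C;
  fvalP : P fval
}.

Definition full_subcategory (C : Category) (P : C -> Prop) : Category :=
  @Build_Category (full_ob P) (fun a b => (a : C) ~> b) (fun a => idc (a : C))
    (fun _ _ _ g f => g ∘ f)
    (fun _ _ f => vcomp_idl f) (fun _ _ f => vcomp_idr f)
    (fun _ _ _ _ h g f => vcomp_assoc h g f).

Lemma full_ob_eq (C : Category) (P : C -> Prop) (a b : full_ob P) :
  fval a = fval b -> a = b.
Proof.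
case: a b => [a Ha] [b Hb] /= e.
by case: _ / e Hb => Hb; rewrite (proof_irrelevance _ Ha Hb).
Qed.

Lemma full_cast (C : Category) (P : C -> Prop) (a b a' b' : full_subcategory P)
    (ea : a = a') (eb : b = b') (f : a ~> b) :
  (cast ea eb f : @arr C (fval a') (fval b'))
  = @cast C _ _ _ _ (f_equal (@fval C P) ea) (f_equal (@fval C P) eb) f.
Proof. by case: _ / ea; case: _ / eb. Qed.

(* [g ⋅ f] is composition of 1-cells, [b ⋆ a] horizontal composition of 2-cells
   and [b ∘ a] (composition in the hom-categories) vertical composition.
   The strict associativity and unit laws for 2-cells only typecheck up to the
   corresponding equalities of 1-cells, whence the casts. *)
Record TwoCat := {
  cell0 :> Type;
  hom : cell0 -> cell0 -> Category;
  id1 : forall x, hom x x;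
  comp1 : forall x y z, hom y z -> hom x y -> hom x z;
  hcomp : forall x y z (g g' : hom y z) (f f' : hom x y),
    g ~> g' -> f ~> f' -> comp1 g f ~> comp1 g' f';
  hcomp_id : forall x y z (g : hom y z) (f : hom x y),
    hcomp (idc g) (idc f) = idc (comp1 g f);
  interchange : forall x y z (g g' g'' : hom y z) (f f' f'' : hom x y)
      (b' : g' ~> g'') (b : g ~> g') (a' : f' ~> f'') (a : f ~> f'),
    hcomp (b' ∘ b) (a' ∘ a) = hcomp b' a' ∘ hcomp b a;
  unitl1 : forall x y (f : hom x y), comp1 (id1 y) f = f;
  unitl2 : forall x y (f f' : hom x y) (a : f ~> f'),
    cast (unitl1 f) (unitl1 f') (hcomp (idc (id1 y)) a) = a;
  unitr1 : forall x y (f : hom x y), comp1 f (id1 x) = f;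
  unitr2 : forall x y (f f' : hom x y) (a : f ~> f'),
    cast (unitr1 f) (unitr1 f') (hcomp a (idc (id1 x))) = a;
  assoc1 : forall w x y z (h : hom y z) (g : hom x y) (f : hom w x),
    comp1 h (comp1 g f) = comp1 (comp1 h g) f;
  assoc2 : forall w x y z (h h' : hom y z) (g g' : hom x y) (f f' : hom w x)
      (c : h ~> h') (b : g ~> g') (a : f ~> f'),
    cast (assoc1 h g f) (assoc1 h' g' f') (hcomp c (hcomp b a))
    = hcomp (hcomp c b) a
}.

Arguments hom {t} x y : rename.
Arguments id1 {t} x : rename.
Arguments comp1 {t x y z} g f : rename.
Arguments hcomp {t x y z g g' f f'} b a : rename.

Notation "g ⋅ f" := (comp1 g f) : cat_scope.
Notation "b ⋆ a" := (hcomp b a) : cat_scope.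

Lemma hcomp_castl (B : TwoCat) (x y z : B) (g g' k : hom y z) (f f' : hom x y)
    (e : g = k) (b : g ~> g') (a : f ~> f') :
  cast e eq_refl b ⋆ a = cast (f_equal (fun h => h ⋅ f) e) eq_refl (b ⋆ a).
Proof. by case: _ / e. Qed.

Lemma assoc2' (B : TwoCat) (w x y z : B) (h h' : hom y z) (g g' : hom x y)
    (f f' : hom w x) (c : h ~> h') (b : g ~> g') (a : f ~> f') :
  c ⋆ (b ⋆ a)
  = cast (eq_sym (assoc1 h g f)) (eq_sym (assoc1 h' g' f')) ((c ⋆ b) ⋆ a).
Proof. by rewrite -assoc2 cast_cast cast_id. Qed.

Lemma hcomp_unitl (B : TwoCat) (x y : B) (f f' : hom x y) (a : f ~> f') :
  idc (id1 y) ⋆ a = cast (eq_sym (unitl1 f)) (eq_sym (unitl1 f')) a.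
Proof. by rewrite -{2}[a]unitl2 cast_cast cast_id. Qed.

Lemma hcomp_unitr (B : TwoCat) (x y : B) (f f' : hom x y) (a : f ~> f') :
  a ⋆ idc (id1 x) = cast (eq_sym (unitr1 f)) (eq_sym (unitr1 f')) a.
Proof. by rewrite -{2}[a]unitr2 cast_cast cast_id. Qed.

Definition biterminal (D : TwoCat) (t : D) : Prop :=
  forall z : D, equivalent (hom z t) terminal_category.

Record TwoFunctor (E B : TwoCat) := {
  ob2 :> E -> B;
  fun2 : forall u v : E, Functor (hom u v) (hom (ob2 u) (ob2 v));
  fun2_id : forall u, fun2 u u (id1 u) = id1 (ob2 u);
  fun2_comp1 : forall (u v w : E) (g : hom v w) (f : hom u v),
    fun2 u w (g ⋅ f) = fun2 v w g ⋅ fun2 u v f;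
  fun2_hcomp : forall (u v w : E) (g g' : hom v w) (f f' : hom u v)
      (b : g ~> g') (a : f ~> f'),
    cast (fun2_comp1 g f) (fun2_comp1 g' f') (fmap (fun2 u w) (b ⋆ a))
    = fmap (fun2 v w) b ⋆ fmap (fun2 u v) a
}.

Arguments fun2 {E B} p {u v} : rename.

Definition postcomp (B : TwoCat) (a u v : B) (f : hom u v) :
  Functor (hom a u) (hom a v).
Proof.
refine (@Build_Functor (hom a u) (hom a v) (fun g => f ⋅ g)
          (fun _ _ s => idc f ⋆ s) _ _).
- by move=> g; rewrite hcomp_id.
- by move=> g g' g'' s' s; rewrite -interchange vcomp_idl.
Defined.

Definition cartesian (E B : TwoCat) (p : TwoFunctor E B) (u v : E)
    (f : hom u v) : Prop :=
  forall a : E,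
    is_pullback (postcomp a f) (fun2 p) (fun2 p) (postcomp (p a) (fun2 p f)).

Lemma postcomp_id (B : TwoCat) (a u : B) : postcomp a (id1 u) = idF (hom a u).
Proof.
apply: (@functor_ext _ _ (postcomp a (id1 u)) (idF _) (@unitl1 B a u)) => g g' s /=.
exact: unitl2.
Qed.

Lemma postcomp_comp (B : TwoCat) (a u v w : B) (g : hom v w) (f : hom u v) :
  postcomp a (g ⋅ f) = compF (postcomp a g) (postcomp a f).
Proof.
apply: (@functor_ext _ _ (postcomp a (g ⋅ f))
          (compF (postcomp a g) (postcomp a f))
          (fun h => eq_sym (assoc1 g f h))) => h h' s /=.
by apply: cast_move; rewrite -hcomp_id -assoc2; apply: cast_pi.
Qed.

Lemma pullback_id (A C : Category) (Q : Functor A C) :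
  is_pullback (idF A) Q Q (idF C).
Proof.
split; first by rewrite compF_idl compF_idr.
move=> X S T; rewrite compF_idl => H; exists S; split.
- by rewrite compF_idl.
- by move=> U [<- _]; rewrite compF_idl.
Qed.

Lemma pullback_comp (A1 A2 A3 C1 C2 C3 : Category)
    (P1 : Functor A1 A2) (P2 : Functor A2 A3) (G1 : Functor C1 C2)
    (G2 : Functor C2 C3) (Q1 : Functor A1 C1) (Q2 : Functor A2 C2)
    (Q3 : Functor A3 C3) :
  is_pullback P1 Q1 Q2 G1 -> is_pullback P2 Q2 Q3 G2 ->
  is_pullback (compF P2 P1) Q1 Q3 (compF G2 G1).
Proof.
move=> [c1 u1] [c2 u2]; split.
  by rewrite compF_assoc c2 -compF_assoc c1 compF_assoc.
move=> X S T H.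
have [V [[V1 V2] Vu]] := u2 X S (compF G1 T) (eq_trans H (eq_sym (compF_assoc _ _ _))).
have [U [[U1 U2] Uu]] := u1 X V T V2.
exists U; split; first by rewrite -compF_assoc U1.
move=> W [W1 W2]; apply: Uu; split=> //.
symmetry; apply: Vu; split; first by rewrite compF_assoc.
by rewrite compF_assoc c1 -compF_assoc W2.
Qed.

Lemma cartesian_id (E B : TwoCat) (p : TwoFunctor E B) (u : E) :
  cartesian p (id1 u).
Proof.
move=> a; rewrite fun2_id !postcomp_id; exact: pullback_id.
Qed.

Lemma cartesian_comp (E B : TwoCat) (p : TwoFunctor E B) (u v w : E)
    (g : hom v w) (f : hom u v) :
  cartesian p g -> cartesian p f -> cartesian p (g ⋅ f).
Proof.
move=> cg cf a; rewrite fun2_comp1 !postcomp_comp.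
exact: pullback_comp (cf a) (cg a).
Qed.

Definition cart_hom (E B : TwoCat) (p : TwoFunctor E B) (u v : E) : Category :=
  full_subcategory (@cartesian E B p u v).

Definition cart_id1 (E B : TwoCat) (p : TwoFunctor E B) (u : E) :
  cart_hom p u u :=
  @Build_full_ob (hom u u) _ (id1 u) (cartesian_id p u).

Definition cart_comp1 (E B : TwoCat) (p : TwoFunctor E B) (u v w : E)
    (g : cart_hom p v w) (f : cart_hom p u v) : cart_hom p u w :=
  @Build_full_ob (hom u w) _ (fval g ⋅ fval f)
    (cartesian_comp (fvalP g) (fvalP f)).

Definition cart_hcomp (E B : TwoCat) (p : TwoFunctor E B) (u v w : E)
    (g g' : cart_hom p v w) (f f' : cart_hom p u v) (b : g ~> g') (a : f ~> f') :
  cart_comp1 g f ~> cart_comp1 g' f' :=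
  @hcomp E u v w (fval g) (fval g') (fval f) (fval f') b a.

Definition cart (E B : TwoCat) (p : TwoFunctor E B) : TwoCat.
Proof.
refine (@Build_TwoCat E (@cart_hom E B p) (@cart_id1 E B p)
  (@cart_comp1 E B p) (@cart_hcomp E B p) _ _
  (fun u v f => @full_ob_eq _ _ (cart_comp1 (cart_id1 p v) f) f (unitl1 _)) _
  (fun u v f => @full_ob_eq _ _ (cart_comp1 f (cart_id1 p u)) f (unitr1 _)) _
  (fun u v w z h g f => @full_ob_eq _ _
     (cart_comp1 h (cart_comp1 g f)) (cart_comp1 (cart_comp1 h g) f)
     (assoc1 _ _ _)) _).
- by move=> u v w g f; apply: hcomp_id.
- by move=> u v w g g' g'' f f' f'' b' b a' a; apply: interchange.
- move=> u v f f' a; rewrite full_cast -[RHS]unitl2; exact: (@cast_pi (hom u v)).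
- move=> u v f f' a; rewrite full_cast -[RHS]unitr2; exact: (@cast_pi (hom u v)).
- move=> u v w z h h' g g' f f' c b a.
  rewrite full_cast -[RHS]assoc2; exact: (@cast_pi (hom u z)).
Defined.

Section LaxSlice.

Variables (B : TwoCat) (x : B).

Record slice_ob := SliceOb {
  s_ob : B;
  s_leg : hom s_ob x
}.

(* [s_tri] points from the composite to the leg of the source. *)
Record slice_1cell (Y Z : slice_ob) := SliceCell {
  s_map : hom (s_ob Y) (s_ob Z);
  s_tri : s_leg Z ⋅ s_map ~> s_leg Y
}.

Record slice_2cell (Y Z : slice_ob) (F G : slice_1cell Y Z) := SliceTwoCell {
  s_cell : s_map F ~> s_map G;
  s_cellP : s_tri G ∘ (idc (s_leg Z) ⋆ s_cell) = s_tri F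
}.

Lemma slice_2cell_eq (Y Z : slice_ob) (F G : slice_1cell Y Z)
  (X X' : slice_2cell F G) : s_cell X = s_cell X' -> X = X'.
Proof.
case: X X' => [a Ha] [b Hb] /= e.
by case: _ / e Hb => Hb; rewrite (proof_irrelevance _ Ha Hb).
Qed.

Lemma slice_1cell_eq (Y Z : slice_ob) (F G : slice_1cell Y Z)
    (e : s_map F = s_map G) :
  cast (f_equal (comp1 (s_leg Z)) e) eq_refl (s_tri F) = s_tri G -> F = G.
Proof.
case: F G e => [f c] [g d] /= e.
by case: _ / e d => d /= ->.
Qed.

Definition slice_2id (Y Z : slice_ob) (F : slice_1cell Y Z) : slice_2cell F F.
Proof.
refine (@SliceTwoCell _ _ F F (idc (s_map F)) _).
by rewrite hcomp_id vcomp_idr.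
Defined.

Definition slice_vcomp (Y Z : slice_ob) (F G H : slice_1cell Y Z)
  (b : slice_2cell G H) (a : slice_2cell F G) : slice_2cell F H.
Proof.
refine (@SliceTwoCell _ _ F H (s_cell b ∘ s_cell a) _).
by rewrite -[idc _]vcomp_idl interchange vcomp_assoc !s_cellP.
Defined.

Definition slice_hom (Y Z : slice_ob) : Category.
Proof.
refine (@Build_Category (slice_1cell Y Z) (@slice_2cell Y Z) (@slice_2id Y Z)
          (@slice_vcomp Y Z) _ _ _).
- by move=> F G a; apply: slice_2cell_eq; apply: vcomp_idl.
- by move=> F G a; apply: slice_2cell_eq; apply: vcomp_idr.
- by move=> F G H K c b a; apply: slice_2cell_eq; apply: vcomp_assoc.
Defined.

(* With strict laws the identity on (y, α) is (1, id_α) and the composite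
   (g, δ)(f, γ) is (g f, γ ∘ (δ f)); the casts along α 1 = α and
   ζ (g f) = (ζ g) f only adjust the source of the 2-cell. *)
Definition slice_id1 (Y : slice_ob) : slice_hom Y Y :=
  @SliceCell Y Y (id1 (s_ob Y))
    (cast (eq_sym (unitr1 (s_leg Y))) eq_refl (idc (s_leg Y))).

Definition slice_comp1 (Y Z W : slice_ob) (G : slice_hom Z W)
    (F : slice_hom Y Z) : slice_hom Y W :=
  @SliceCell Y W (s_map G ⋅ s_map F)
    (s_tri F ∘ cast (eq_sym (assoc1 (s_leg W) (s_map G) (s_map F))) eq_refl
                 (s_tri G ⋆ idc (s_map F))).

Lemma slice_cast (Y Z : slice_ob) (F F' G G' : slice_hom Y Z) (e : F = F')
    (e' : G = G') (a : F ~> G) :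
  s_cell (cast e e' a)
  = cast (f_equal (@s_map Y Z) e) (f_equal (@s_map Y Z) e') (s_cell a).
Proof. by case: _ / e; case: _ / e'. Qed.

Definition slice_hcomp (Y Z W : slice_ob) (G G' : slice_hom Z W)
    (F F' : slice_hom Y Z) (b : G ~> G') (a : F ~> F') :
  slice_comp1 G F ~> slice_comp1 G' F'.
Proof.
refine (@SliceTwoCell _ _ (slice_comp1 G F) (slice_comp1 G' F')
          (s_cell b ⋆ s_cell a) _).
rewrite /= assoc2' -vcomp_assoc cast_vcomp -interchange s_cellP vcomp_idl.
rewrite -[s_tri G]vcomp_idl -[s_cell a]vcomp_idr interchange cast_vcompr.
by rewrite vcomp_idl vcomp_assoc s_cellP.
Defined.

Lemma slice_unitl1 (Y Z : slice_ob) (F : slice_hom Y Z) :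
  slice_comp1 (slice_id1 Z) F = F.
Proof.
apply: (@slice_1cell_eq _ _ (slice_comp1 (slice_id1 Z) F) F (unitl1 (s_map F))).
rewrite /= hcomp_castl hcomp_id cast_cast -cast_vcompr vcomp_idr cast_cast.
exact: cast_id.
Qed.

Lemma slice_unitr1 (Y Z : slice_ob) (F : slice_hom Y Z) :
  slice_comp1 F (slice_id1 Y) = F.
Proof.
apply: (@slice_1cell_eq _ _ (slice_comp1 F (slice_id1 Y)) F (unitr1 (s_map F))).
rewrite /= hcomp_unitr cast_cast cast_vcomp.
by rewrite vcomp_idl cast_cast cast_id.
Qed.

Lemma slice_assoc1 (Y Z W V : slice_ob) (H : slice_hom W V) (G : slice_hom Z W)
    (F : slice_hom Y Z) :
  slice_comp1 H (slice_comp1 G F) = slice_comp1 (slice_comp1 H G) F.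
Proof.
apply: (@slice_1cell_eq _ _ (slice_comp1 H (slice_comp1 G F))
          (slice_comp1 (slice_comp1 H G) F)
          (assoc1 (s_map H) (s_map G) (s_map F))).
rewrite /= cast_vcompr -vcomp_assoc cast_cast; congr (_ ∘ _).
rewrite -[in RHS](vcomp_idl (idc (s_map F))) interchange hcomp_castl.
rewrite -hcomp_id assoc2' cast_cast.
rewrite cast_vcomp -cast_vcompr cast_cast.
exact: cast_pi.
Qed.

Definition lax_slice : TwoCat.
Proof.
refine (@Build_TwoCat slice_ob slice_hom slice_id1 slice_comp1 slice_hcomp
          _ _ slice_unitl1 _ slice_unitr1 _ slice_assoc1 _).
- by move=> Y Z W G F; apply: slice_2cell_eq; apply: hcomp_id.
- move=> Y Z W G G' G'' F F' F'' b' b a' a; apply: slice_2cell_eq.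
  exact: interchange.
- move=> Y Z F F' a; apply: slice_2cell_eq; rewrite slice_cast /= -[RHS]unitl2.
  exact: cast_pi.
- move=> Y Z F F' a; apply: slice_2cell_eq; rewrite slice_cast /= -[RHS]unitr2.
  exact: cast_pi.
- move=> Y Z W V H H' G G' F F' c b a; apply: slice_2cell_eq.
  rewrite slice_cast /= -[RHS]assoc2; exact: cast_pi.
Defined.

Definition slice_proj_hom (Y Z : lax_slice) :
  Functor (hom Y Z) (hom (s_ob Y) (s_ob Z)) :=
  @Build_Functor (slice_hom Y Z) (hom (s_ob Y) (s_ob Z)) (@s_map Y Z)
    (@s_cell Y Z) (fun _ => eq_refl) (fun _ _ _ _ _ => eq_refl).

Definition slice_proj : TwoFunctor lax_slice B :=
  @Build_TwoFunctor lax_slice B s_ob slice_proj_hom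
    (fun _ => eq_refl) (fun _ _ _ _ _ => eq_refl)
    (fun _ _ _ _ _ _ _ _ _ => eq_refl).

End LaxSlice.

(* Main.v *)
(** For a fixed 1-cell [h], lifting [(f h, δ)] through [(f, γ)] amounts to
    solving [ε ∘ (γ h) = δ] for [ε].  Hence [(f, γ)] is cartesian exactly when
    [γ] is invertible (for necessity, take [h] to be an identity).  A 2-cell
    [(f, γ) -> (g, δ)] into [(x, 1)] is then forced to be [δ^-1 ∘ γ], so the
    hom-categories into [(x, 1)] of the cartesian part are indiscrete; they are
    inhabited by [(α, id_α)]. *)

From Stdlib Require Import ssreflect IndefiniteDescription.
Require Import Defs.

Set Implicit Arguments.
Unset Strict Implicit.
Unset Printing Implicit Defensive.

Local Open Scope cat_scope.

(** * Transport along equalities, and isomorphisms *)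

Lemma fmap_eq (C D : Category) (F G : Functor C D) (a b : C) (f : a ~> b)
    (ea : F a = G a) (eb : F b = G b) :
  F = G -> cast ea eb (fmap F f) = fmap G f.
Proof. by move=> E; case: _ / E ea eb => ea eb; rewrite cast_id. Qed.

Lemma fob_eq (C D : Category) (F G : Functor C D) (a : C) : F = G -> F a = G a.
Proof. by move=> ->. Qed.

Lemma cast_inj (C : Category) (a b a' b' : C) (ea : a = a') (eb : b = b')
    (f g : a ~> b) : cast ea eb f = cast ea eb g -> f = g.
Proof. by case: _ / ea; case: _ / eb. Qed.

Lemma is_iso_cast (C : Category) (a b a' b' : C) (ea : a = a') (eb : b = b')
    (f : a ~> b) : is_iso f -> is_iso (cast ea eb f).
Proof. by case: _ / ea; case: _ / eb. Qed.

Lemma is_iso_idc (C : Category) (a : C) : is_iso (idc a).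
Proof. by exists (idc a); rewrite vcomp_idl. Qed.

(** Extending [idc a] gives a left inverse [g]; then [f ∘ g] and [idc b] both extend [f] along
    itself, so they agree. *)
Lemma is_iso_of_unique_extension (C : Category) (a b : C) (f : a ~> b) :
  (forall (c : C) (d : a ~> c), exists! e : b ~> c, e ∘ f = d) -> is_iso f.
Proof.
move=> H; have [g [gf _]] := H a (idc a); exists g; split=> //.
have [e [_ u]] := H b f.
transitivity e; first by symmetry; apply: u; rewrite -vcomp_assoc gf vcomp_idr.
by apply: u; rewrite vcomp_idl.
Qed.

(** * Strict pullbacks of categories, and equivalence with the terminal category *)

Definition constF (C D : Category) (d : D) : Functor C D :=
  @Build_Functor C D (fun _ => d) (fun _ _ _ => idc d) (fun _ => eq_refl)
    (fun _ _ _ _ _ => eq_sym (vcomp_idl (idc d))).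

Lemma compF_constF (C D E : Category) (F : Functor D E) (d : D) :
  compF F (constF C d) = constF C (F d).
Proof.
apply: (@functor_ext _ _ (compF F (constF C d)) (constF C (F d))
          (fun _ => eq_refl)) => a b f /=.
exact: fmap_id.
Qed.

(** Objects are functors out of the terminal category, so the universal property is tested on
    constant functors. *)
Lemma pullback_ob (A B C D : Category) (P : Functor A B) (Q : Functor A C)
    (F : Functor B D) (G : Functor C D) (b : B) (c : C) :
  is_pullback P Q F G -> F b = G c -> exists! a : A, P a = b /\ Q a = c.
Proof.
move=> [_ H] e.
have [|U [[PU QU] uU]] :=
    H terminal_category (constF terminal_category b) (constF terminal_category c).
  by rewrite !compF_constF e.
exists (U (tt : terminal_category)); split.
  split; first exact: (@fob_eq terminal_category _ _ _ tt PU).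
  exact: (@fob_eq terminal_category _ _ _ tt QU).
move=> a [Pa Qa]; have -> // : U = constF terminal_category a.
by apply: uU; rewrite !compF_constF Pa Qa.
Qed.

(** Reduces the universal property to separate lifting and uniqueness for objects and for arrows.
    The lifts are asked for as data, so that they assemble into a functor. *)
Lemma pullback_criterion (A B C D : Category) (P : Functor A B)
    (Q : Functor A C) (F : Functor B D) (G : Functor C D)
    (E : forall a, F (P a) = G (Q a)) :
  (forall (a a' : A) (k : a ~> a'),
     cast (E a) (E a') (fmap F (fmap P k)) = fmap G (fmap Q k)) ->
  (forall (b : B) (c : C), F b = G c -> {a : A | P a = b /\ Q a = c}) ->
  (forall a a' : A, P a = P a' -> Q a = Q a' -> a = a') ->
  (forall (a a' : A) (h : P a ~> P a') (g : Q a ~> Q a'),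
     cast (E a) (E a') (fmap F h) = fmap G g ->
     {k : a ~> a' | fmap P k = h /\ fmap Q k = g}) ->
  (forall (a a' : A) (k k' : a ~> a'),
     fmap P k = fmap P k' -> fmap Q k = fmap Q k' -> k = k') ->
  is_pullback P Q F G.
Proof.
move=> comm lob uob larr uarr; split.
  exact: (@functor_ext _ _ (compF F P) (compF G Q) E comm).
move=> X S T ST.
have eST a : F (S a) = G (T a) := fob_eq a ST.
pose U0 a := proj1_sig (lob _ _ (eST a)).
have PU a : P (U0 a) = S a := proj1 (proj2_sig (lob _ _ (eST a))).
have QU a : Q (U0 a) = T a := proj2 (proj2_sig (lob _ _ (eST a))).
(* The images of the chosen objects equal [S a] and [T a] only propositionally, so the arrows are
   transported before being lifted. Functoriality will follow from uniqueness of lifts. *)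
have lU a b (f : a ~> b) :
    {k : U0 a ~> U0 b |
      fmap P k = cast (eq_sym (PU a)) (eq_sym (PU b)) (fmap S f) /\
      fmap Q k = cast (eq_sym (QU a)) (eq_sym (QU b)) (fmap T f)}.
  have /= STf := @fmap_eq _ _ (compF F S) (compF G T) _ _ f (eST a) (eST b) ST.
  by apply: larr; rewrite !fmap_cast -STf !cast_cast; apply: cast_pi.
pose U1 a b f := proj1_sig (lU a b f).
have P1 a b f : fmap P (U1 a b f) = _ := proj1 (proj2_sig (lU a b f)).
have Q1 a b f : fmap Q (U1 a b f) = _ := proj2 (proj2_sig (lU a b f)).
have Ui a : U1 a a (idc a) = idc (U0 a).
  by apply: uarr; rewrite ?P1 ?Q1 !fmap_id cast_idc.
have Uc a b c (g : b ~> c) (f : a ~> b) : U1 a c (g ∘ f) = U1 b c g ∘ U1 a b f.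
  by apply: uarr; rewrite fmap_vcomp ?P1 ?Q1 fmap_vcomp cast_vcomp.
pose U := @Build_Functor X A U0 U1 Ui Uc.
exists U; split.
  split.
    apply: (@functor_ext _ _ (compF P U) S PU) => a b f /=.
    by rewrite P1 cast_cast cast_id.
  apply: (@functor_ext _ _ (compF Q U) T QU) => a b f /=.
  by rewrite Q1 cast_cast cast_id.
move=> V [PV QV].
have eU a : U a = V a.
  apply: uob; first by rewrite [LHS]PU -(fob_eq a PV).
  by rewrite [LHS]QU -(fob_eq a QV).
apply: (@functor_ext _ _ U V eU) => a b f.
have /= PVf := fmap_eq f (fob_eq a PV) (fob_eq b PV) PV.
have /= QVf := fmap_eq f (fob_eq a QV) (fob_eq b QV) QV.
apply: uarr; rewrite fmap_cast /= ?P1 ?Q1 cast_cast; apply: cast_move.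
  by rewrite -PVf; apply: cast_pi.
by rewrite -QVf; apply: cast_pi.
Qed.

Lemma equivalent_terminal (C : Category) (t : C) :
  (forall a b : C, exists! f : a ~> b, True) -> equivalent C terminal_category.
Proof.
move=> H.
have eq_arr (a b : C) (f g : a ~> b) : f = g.
  by have [h [_ u]] := H a b; rewrite -(u f) // -(u g).
(* The components of a natural isomorphism must form a function, hence the choice; its equations all
   hold because parallel arrows agree. *)
have pick (a b : C) : a ~> b.
  apply: (proj1_sig (constructive_indefinite_description (fun _ => True) _)).
  by have [h _] := H a b; exists h.
exists (@constF C terminal_category tt), (constF terminal_category t); split.
  exists (fun a => pick t a); split=> [a b f|a]; first exact: eq_arr.
  by exists (pick a t); split; apply: eq_arr.
exists (fun a => tt); split=> [a b []|[]] //.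
by exists tt.
Qed.

(** * Cartesian 1-cells of the lax slice *)

Section Slice.

Variables (B : TwoCat) (x : B).

(** The induced equality of underlying 1-cells is a loop, so by proof irrelevance the transport
    along it is trivial. *)
Lemma slice_cell_inj (Y Z : slice_ob x) (f : hom (s_ob Y) (s_ob Z))
    (c d : s_leg Z ⋅ f ~> s_leg Y) : SliceCell c = SliceCell d -> c = d.
Proof.
have tri_eq (F G : slice_1cell Y Z) (e : s_map F = s_map G) :
    F = G -> cast (f_equal (comp1 (s_leg Z)) e) eq_refl (s_tri F) = s_tri G.
  by move=> E; case: _ / E e => e; rewrite cast_id.
exact: (tri_eq (SliceCell c) (SliceCell d) eq_refl).
Qed.

(* The 2-cell [γ h], with the source written [β (f h)]. *)
Definition tri_whisker (Y Z : lax_slice x) (F : hom Y Z) (w : B)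
    (h : hom w (s_ob Y)) : s_leg Z ⋅ (s_map F ⋅ h) ~> s_leg Y ⋅ h :=
  cast (eq_sym (assoc1 (s_leg Z) (s_map F) h)) eq_refl (s_tri F ⋆ idc h).

Lemma slice_compE (Y Z W : lax_slice x) (F : hom Y Z)
    (h : hom (s_ob W) (s_ob Y)) (e : s_leg Y ⋅ h ~> s_leg W) :
  F ⋅ (SliceCell e : hom W Y) = SliceCell (e ∘ tri_whisker F h).
Proof. by []. Qed.

(** By interchange, both sides are [s_tri F ⋆ s] up to transport. *)
Lemma tri_whisker_natural (Y Z : lax_slice x) (F : hom Y Z) (w : B)
    (h h' : hom w (s_ob Y)) (s : h ~> h') :
  tri_whisker F h' ∘ (idc (s_leg Z) ⋆ (idc (s_map F) ⋆ s))
  = (idc (s_leg Y) ⋆ s) ∘ tri_whisker F h.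
Proof.
rewrite /tri_whisker assoc2' cast_vcomp -cast_vcompr -!interchange hcomp_id.
by rewrite !vcomp_idl !vcomp_idr.
Qed.

Lemma tri_whisker_iso (Y Z : lax_slice x) (F : hom Y Z) (w : B)
    (h : hom w (s_ob Y)) : is_iso (s_tri F) -> is_iso (tri_whisker F h).
Proof.
move=> [g [gF Fg]]; apply: is_iso_cast; exists (g ⋆ idc h).
by rewrite -!interchange gF Fg !vcomp_idl !hcomp_id.
Qed.

Lemma tri_whisker_id1 (Y Z : lax_slice x) (F : hom Y Z) :
  tri_whisker F (id1 (s_ob Y))
  = cast (eq_sym (f_equal (comp1 (s_leg Z)) (unitr1 (s_map F))))
      (eq_sym (unitr1 (s_leg Y))) (s_tri F).
Proof. by rewrite /tri_whisker hcomp_unitr cast_cast; apply: cast_pi. Qed.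

Lemma cartesian_of_tri_iso (Y Z : lax_slice x) (F : hom Y Z) :
  is_iso (s_tri F) -> cartesian (slice_proj x) F.
Proof.
move=> isoF W.
(* Right cancellation of [γ h] gives uniqueness of lifts and also reduces the condition on
   2-cells. *)
have epi (h : hom (s_ob W) (s_ob Y)) v (e e' : s_leg Y ⋅ h ~> v) :
    e ∘ tri_whisker F h = e' ∘ tri_whisker F h -> e = e'.
  have [g [_ Fg]] := tri_whisker_iso h isoF.
  move=> H; rewrite -[e]vcomp_idr -[e']vcomp_idr -Fg.
  by rewrite !vcomp_assoc H.
apply: (@pullback_criterion _ _ _ _ (postcomp W F) (fun2 (slice_proj x))
          (fun2 (slice_proj x))
          (postcomp (s_ob W) (fun2 (slice_proj x) F)) (fun _ => eq_refl)).
- by [].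
- move=> [m d] /= h e.
  apply: constructive_indefinite_description.
  case: _ / (eq_sym e) d => d {e}.
  have [g [gF _]] := tri_whisker_iso h isoF.
  exists (SliceCell (d ∘ g)); split=> //.
  by rewrite [LHS]slice_compE -vcomp_assoc gF vcomp_idr.
- move=> [h e] [h' e'] /= E Eh.
  case: _ / Eh e' E => e' E; congr (SliceCell _).
  by apply: epi; apply: slice_cell_inj E.
- move=> K K' t s /= ts.
  (* After precomposition with [γ h], naturality turns the condition on [s] into the one that [t]
     satisfies. *)
  have sP : s_tri K' ∘ (idc (s_leg Y) ⋆ s) = s_tri K.
    apply: epi; rewrite -vcomp_assoc -tri_whisker_natural -ts vcomp_assoc.
    exact: (s_cellP t).
  by exists (SliceTwoCell sP); split=> //; apply: slice_2cell_eq.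
- by move=> K K' k k' _ /= E; apply: slice_2cell_eq.
Qed.

(* The lifts of [(f 1, d)] along the identity 1-cell are the extensions of [d]
   along [γ]. *)
Lemma tri_unique_extension (Y Z : lax_slice x) (F : hom Y Z)
    (v : hom (s_ob Y) x) (d : s_leg Z ⋅ s_map F ~> v) :
  cartesian (slice_proj x) F -> exists! e : s_leg Y ~> v, e ∘ s_tri F = d.
Proof.
(* Taking the target [v] of [d] as a leg makes 2-cells into [v] the triangles of 1-cells out of [W]:
   [S] encodes the problems, [L] the candidate solutions. *)
pose W : lax_slice x := SliceOb v.
pose S (d' : s_leg Z ⋅ s_map F ~> v) : hom W Z :=
  @SliceCell _ _ W Z (s_map F ⋅ id1 (s_ob Y))
    (cast (eq_sym (f_equal (comp1 (s_leg Z)) (unitr1 (s_map F)))) eq_refl d').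
pose L (e : s_leg Y ~> v) : hom W Y :=
  @SliceCell _ _ W Y (id1 (s_ob Y)) (cast (eq_sym (unitr1 (s_leg Y))) eq_refl e).
have FL e : F ⋅ L e = S (e ∘ s_tri F).
  by rewrite slice_compE tri_whisker_id1 cast_vcomp.
have injS d1 d2 : S d1 = S d2 -> d1 = d2.
  by move=> E; apply: cast_inj (slice_cell_inj E).
have injL e1 e2 : L e1 = L e2 -> e1 = e2.
  by move=> E; apply: cast_inj (slice_cell_inj E).
(* Every 1-cell over the identity is some [L e], so the unique lift supplied by the pullback yields
   an extension. *)
have surjL (K : hom W Y) : s_map K = id1 (s_ob Y) -> exists e, K = L e.
  case: K => k e /= E; case: _ / (eq_sym E) e => e {E}.
  exists (cast (unitr1 (s_leg Y)) eq_refl e).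
  by rewrite /L cast_cast cast_id.
move=> cF.
have [|K [[FK mK] uK]] := @pullback_ob _ _ _ _ _ _ _ _ (S d) (id1 (s_ob Y)) (cF W).
  by [].
have [e eK] := surjL K mK; exists e; split.
  by apply: injS; rewrite -FL -eK.
move=> e' e'F; apply: injL; rewrite -eK; apply: uK; split=> //.
by rewrite [LHS]FL e'F.
Qed.

Lemma cartesian_tri_iso (Y Z : lax_slice x) (F : hom Y Z) :
  cartesian (slice_proj x) F -> is_iso (s_tri F).
Proof.
move=> cF; apply: is_iso_of_unique_extension => v d.
exact: tri_unique_extension.
Qed.

Lemma slice_2cell_to_id_unique (Y : lax_slice x)
    (F G : hom Y (SliceOb (id1 x) : lax_slice x)) :
  is_iso (s_tri G) -> exists! s : F ~> G, True.
Proof.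
move=> [g [gG Gg]].
(* The leg of the target is an identity, so the triangles start at [id1 x ⋅ f]; the casts remove
   this identity. *)
pose c : s_map F ~> s_map G := cast (unitl1 _) (unitl1 _) (g ∘ s_tri F).
have cP : s_tri G ∘ (idc (id1 x) ⋆ c) = s_tri F.
  by rewrite hcomp_unitl cast_cast cast_id vcomp_assoc Gg vcomp_idl.
exists (@SliceTwoCell _ _ _ _ F G c cP); split=> // s _.
apply: slice_2cell_eq; rewrite /= /c -(s_cellP s) vcomp_assoc gG vcomp_idl.
exact: unitl2.
Qed.

End Slice.

Theorem proposition3p2p4 (B : TwoCat) (x : B) :
  @biterminal (cart (slice_proj x)) (SliceOb (id1 x) : lax_slice x).
Proof.
move=> Y.
pose T : hom (Y : lax_slice x) (SliceOb (id1 x) : lax_slice x) :=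
  @SliceCell _ _ Y (SliceOb (id1 x)) (s_leg Y)
    (cast (eq_sym (unitl1 (s_leg Y))) eq_refl (idc (s_leg Y))).
have cT : cartesian (slice_proj x) T.
  by apply: cartesian_of_tri_iso; apply: is_iso_cast; apply: is_iso_idc.
apply: (@equivalent_terminal (cart_hom (slice_proj x) Y _) (Build_full_ob cT)).
move=> F G.
(* Fullness makes the 2-cells here those of the lax slice, and invertibility is required only of the
   triangle of the target [G]. *)
exact: slice_2cell_to_id_unique (cartesian_tri_iso (fvalP G)).
Qed.
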